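(* Let $\mathcal{P}$ be a family of compact subsets of $\mathbb{R}$ such that $\{0\}\notin\mathcal{P}$. Let $\kappa$ be a cardinal number. The set $$\{f\in C(\beta\mathbb{N}\setminus\mathbb{N}):\operatorname{rng}(f)\in\mathcal{P}\}$$ is $\kappa$-lineable if and only if the set $$\{x\in\ell_\infty:\operatorname{Lim}(x)\in\mathcal{P}\}$$ is $\kappa$-lineable.
   Context: A subset $M$ of a linear space $X$ is $\kappa$-lineable if $M\cup\{0\}$ contains a linear subspace of dimension $\kappa$. $\ell_\infty$ is the space of bounded real sequences; $\operatorname{Lim}(x)$ is the set of cluster points of the sequence $x$, i.e. of those $t\in\mathbb{R}$ such that $\{n\in\mathbb{N}:t-\varepsilon<x(n)<t+\varepsilon\}$ is infinite for every $\varepsilon>0$. $\beta\mathbb{N}\setminus\mathbb{N}$ is the remainder of the Čech–Stone compactification of the discrete space $\mathbb{N}$, i.e. the compact space of non-principal ultrafilters on $\mathbb{N}$; $C(\beta\mathbb{N}\setminus\mathbb{N})$ is the space of real-valued continuous functions on it, and $\operatorname{rng}(f)$ is the range of $f$. *)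

(* Defs.v *)
From HB Require Import structures.
From mathcomp Require Import all_boot all_order all_algebra.
From mathcomp Require Import all_classical all_reals all_analysis.

Set Implicit Arguments.
Unset Strict Implicit.
Unset Printing Implicit Defensive.
Import Order.TTheory GRing.Theory Num.Theory.
Import numFieldNormedType.Exports.
Local Open Scope classical_set_scope.
Local Open Scope card_scope.
Local Open Scope ring_scope.

Section Lineable.
Variables (R : fieldType) (X : lmodType R).
Implicit Types (B V M : set X).

Definition linear_span B : set X :=
  [set v | exists (s : seq X) (c : X -> R),
     [set` s] `<=` B /\ v = \sum_(b <- s) c b *: b].

Definition linearly_independent B : Prop :=
  forall (s : seq X) (c : X -> R), uniq s -> [set` s] `<=` B ->
    \sum_(b <- s) c b *: b = 0 -> forall b, b \in s -> c b = 0.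

Definition hamel_basis B V : Prop :=
  linearly_independent B /\ linear_span B = V.

(* A cardinal number is represented by any type of that cardinality. *)
Definition has_dim (kappa : Type) V : Prop :=
  exists B, hamel_basis B V /\ B #= [set: kappa].

Definition lineable (kappa : Type) M : Prop :=
  exists V, [/\ submod_closed (mem V), has_dim kappa V & V `<=` M `|` [set 0]].

End Lineable.

(* [beta N] is realized as the Stone space of ultrafilters on [nat], so its
   remainder consists of the ultrafilters that are not [principal_filter n],
   topologized by the sets of ultrafilters containing a given [A]. *)
Definition nonprincipal_ultrafilter (F : set_system nat) : Prop :=
  UltraFilter F /\ forall n, F <> principal_filter n.

Definition betaN_remainder : Type :=
  {F : set_system nat | nonprincipal_ultrafilter F}.

HB.instance Definition _ := gen_eqMixin betaN_remainder.
HB.instance Definition _ := gen_choiceMixin betaN_remainder.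

Definition stone_base (A : set nat) : set betaN_remainder :=
  [set p | sval p A].

Lemma stone_base_cover : \bigcup_(A in [set: set nat]) stone_base A = setT.
Proof.
apply/seteqP; split=> // -[F [FU Fnp]] _; exists setT => //=.
exact: filterT.
Qed.

Lemma stone_base_join (A B : set nat) (p : betaN_remainder) :
  [set: set nat] A -> [set: set nat] B -> stone_base A p -> stone_base B p ->
  exists C, [/\ [set: set nat] C, stone_base C p &
                stone_base C `<=` stone_base A `&` stone_base B].
Proof.
move=> _ _; case: p => F [FU Fnp] /= FA FB; exists (A `&` B); split=> //=.
  exact: filterI.
move=> [G [GU Gnp]] /= GAB; split=> /=; apply: filterS GAB => n [] //.
Qed.

HB.instance Definition _ := isBaseTopological.Build betaN_remainder
  stone_base_cover stone_base_join.

(* The vector space C(T) is the library's [continuousType T R] with the pointwise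
   operations inherited from [T -> R]. *)
Section ContinuousFunctions.
Variables (T : topologicalType) (R : realType).
Local Notation C := (continuousType T R).

Definition continuous_pred : {pred T -> R} := mem [set f | continuous f].

Definition continuous_Sub (f : T -> R) (fP : f \in continuous_pred) : C :=
  mkcts (set_mem fP).

Lemma continuous_rect (K : C -> Type) :
  (forall f (fP : f \in continuous_pred), K (continuous_Sub fP)) ->
  forall f : C, K f.
Proof.
move=> Ksub f.
have fP : (f : T -> R) \in continuous_pred by apply/mem_set; exact: cts_fun.
suff -> : f = continuous_Sub fP by [].
exact/continuousEP.
Qed.

Lemma continuous_valP f (fP : f \in continuous_pred) :
  continuous_Sub fP = f :> (T -> R).
Proof. by []. Qed.

HB.instance Definition _ :=
  isSub.Build (T -> R) continuous_pred C continuous_rect continuous_valP.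

Lemma continuous_submod_closed : submod_closed continuous_pred.
Proof.
split=> [|a f g]; first by apply/mem_set => x; exact: cvg_cst.
move=> /set_mem fc /set_mem gc; apply/mem_set => x.
apply: (@continuousD _ _ _ (a *: f) g x); last exact: gc.
by apply: (@continuousM _ _ (fun=> a) f x); [exact: cvg_cst|exact: fc].
Qed.

HB.instance Definition _ := GRing.isSubmodClosed.Build _ _ continuous_pred
  continuous_submod_closed.

HB.instance Definition _ := [SubChoice_isSubLmodule of C by <:].

End ContinuousFunctions.

Section BoundedSequences.
Variable R : realType.

Definition bounded_seq_pred : {pred nat -> R} :=
  mem [set x : nat -> R | bounded_fun x].

Record l_infty := LInfty
  { l_infty_val :> nat -> R; _ : l_infty_val \in bounded_seq_pred }.

HB.instance Definition _ := [isSub for l_infty_val].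
HB.instance Definition _ := [Choice of l_infty by <:].

Lemma bounded_seqP (x : nat -> R) :
  reflect (exists M, forall n, `|x n| <= M) (x \in bounded_seq_pred).
Proof.
have PF : ProperFilter (globally [set: nat]) by exact: (@globally_properfilter _ _ 0%N).
apply: (iffP idP) => [/set_mem/ex_bound[M xM]|[M xM]].
  by exists M => n; exact: xM.
by apply/mem_set/ex_bound; exists M => n _; exact: xM.
Qed.

Lemma bounded_seq_submod_closed : submod_closed bounded_seq_pred.
Proof.
split=> [|a x y].
  by apply/bounded_seqP; exists 0 => n; rewrite normr0.
move=> /bounded_seqP[A xA] /bounded_seqP[B yB]; apply/bounded_seqP.
exists (`|a| * A + B) => n.
apply: le_trans (ler_normD _ _) _; apply: lerD; last exact: yB.
by rewrite normrM ler_wpM2l// xA.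
Qed.

HB.instance Definition _ := GRing.isSubmodClosed.Build _ _ bounded_seq_pred
  bounded_seq_submod_closed.

HB.instance Definition _ := [SubChoice_isSubLmodule of l_infty by <:].

Definition Lim (x : nat -> R) : set R :=
  [set t | forall e : R, 0 < e -> infinite_set [set n | t - e < x n < t + e]].

End BoundedSequences.

(* Main.v *)
(* Taking limits along nonprincipal ultrafilters, [x |-> (p |-> lim_p x)],
   defines a linear map from l_infty onto C(betaN \ N) such that the range of
   the image of [x] is [Lim x]; its kernel is the space of null sequences. As [P]
   does not contain [{0}], the map is injective on every subspace witnessing
   lineability in l_infty, so such a subspace can be pushed forward; conversely,
   the span of arbitrary preimages of a Hamel basis is a lift of a subspace of
   C(betaN \ N) of the same dimension. *)

From HB Require Import structures.
Require Import Defs.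
From mathcomp Require Import all_boot all_order all_algebra.
From mathcomp Require Import all_classical all_reals all_analysis.
From mathcomp Require Import lra.
Import Order.TTheory GRing.Theory Num.Theory.
Import numFieldNormedType.Exports.
Local Open Scope classical_set_scope.
Local Open Scope card_scope.
Local Open Scope ring_scope.

(** * Linear spans of sets *)

Section LinearSpan.
Variables (R : fieldType) (X : lmodType R).
Implicit Types (B : set X) (s t : seq X).

(** Equal terms are grouped, so each coefficient is multiplied by its multiplicity in [s]. Allowing
    a larger [t] brings two combinations over one duplicate-free list. *)
Lemma lincomb_undup s t (c : X -> R) : {subset s <= t} ->
  \sum_(b <- s) c b *: b = \sum_(b <- undup t) (c b *+ count_mem b s) *: b.
Proof.
move=> st; transitivity (\sum_(b <- undup t) \sum_(a <- s | a == b) c a *: a).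
  rewrite (exchange_big_dep xpredT)//= [LHS]big_seq [RHS]big_seq.
  apply: eq_bigr => a /st ta.
  rewrite (eq_bigl (pred1 a)); last by move=> b; rewrite /= eq_sym.
  by rewrite -big_filter filter_pred1_uniq ?undup_uniq ?mem_undup// big_seq1.
apply: eq_bigr => b _; rewrite (eq_bigr (fun=> c b *: b)) => [|a /eqP->//].
by rewrite big_const_seq iter_addr_0 scalerMnl.
Qed.

Lemma linear_span_submod_closed B : submod_closed (mem (linear_span B)).
Proof.
split=> [|a u v].
  by rewrite inE; exists [::], (fun=> 0); split=> [x|]; rewrite ?big_nil.
rewrite !inE => -[s [c [sB ->]]] [t [d [tB ->]]].
exists (undup (s ++ t)),
  (fun b => a * (c b *+ count_mem b s) + d b *+ count_mem b t).
split=> [b|].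
  by rewrite /= mem_undup mem_cat => /orP[/sB|/tB].
under [RHS]eq_bigr do rewrite scalerDl -scalerA.
rewrite big_split/= -scaler_sumr; congr (_ *: _ + _).
  by apply: lincomb_undup => x; rewrite mem_cat => ->.
by apply: lincomb_undup => x; rewrite mem_cat orbC => ->.
Qed.

Lemma linear_span_sum (I : eqType) B (r : seq I) (c : I -> R) (g : I -> X) :
  (forall i, i \in r -> B (g i)) -> linear_span B (\sum_(i <- r) c i *: g i).
Proof.
have [B0 BD] := linear_span_submod_closed B.
elim: r => [_|i r IH rB]; first by rewrite big_nil; exact/set_mem.
rewrite big_cons; apply/set_mem/BD; apply/mem_set; last first.
  by apply: IH => j jr; apply: rB; rewrite inE jr orbT.
exists [:: g i], (fun=> 1); rewrite big_seq1 scale1r; split=> // x.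
by rewrite /= inE => /eqP->; apply: rB; rewrite mem_head.
Qed.

End LinearSpan.

(** * Bases and lineability under a linear map *)

Section LinearImage.
Variables (R : fieldType) (X Y : lmodType R) (f : {linear X -> Y}).
Implicit Types B : set X.

Lemma linear_lincomb (I : Type) (r : seq I) (c : I -> R) (g : I -> X) :
  f (\sum_(i <- r) c i *: g i) = \sum_(i <- r) c i *: f (g i).
Proof. by rewrite linear_sum; apply: eq_bigr => i _; rewrite linearZ. Qed.

Lemma image_section B : exists g : Y -> X,
  forall y, (f @` B) y -> B (g y) /\ f (g y) = y.
Proof.
suff : forall y, exists x, (f @` B) y -> B x /\ f x = y.
  by move=> /choice[g gP]; exists g.
move=> y.
by have [[x Bx fx]|nB] := pselect ((f @` B) y); [exists x|exists 0].
Qed.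

Lemma image_linear_span B : f @` linear_span B = linear_span (f @` B).
Proof.
apply/seteqP; split=> [_ [_ [s [c [sB ->]]] <-]|_ [s [c [sB ->]]]].
  by rewrite linear_lincomb; apply: linear_span_sum => b /sB; exists b.
have [g gP] := image_section B.
exists (\sum_(y <- s) c y *: g y).
  by apply: linear_span_sum => y /sB /gP[].
by rewrite linear_lincomb; apply: eq_big_seq => y /sB /gP[_ ->].
Qed.

(** A relation among the images, pulled back along a section, gives a vector of the span of [B] in
    the kernel, hence a relation in [B]. *)
Lemma linearly_independent_image B :
  (forall v, linear_span B v -> f v = 0 -> v = 0) ->
  linearly_independent B -> linearly_independent (f @` B).
Proof.
move=> f0 Bfree s c us sB s0 y ys.
have [g gP] := image_section B.
have fgK : {in s, cancel g f} by move=> z /sB /gP[].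
have gsB : [set` [seq g z | z <- s]] `<=` B.
  by move=> _ /mapP[z /sB /gP[Bz _] ->].
rewrite -(fgK _ ys).
apply: (Bfree _ (c \o f) _ gsB) => //; last exact: map_f.
  by rewrite map_inj_in_uniq// => z t /fgK {2}<- /fgK {2}<- ->.
apply: f0; first by exists [seq g z | z <- s], (c \o f).
rewrite linear_lincomb big_map -[RHS]s0.
by apply: eq_big_seq => z /= /fgK->.
Qed.

(** Since [f] keeps the vectors of [s] distinct, applying it yields a relation in the image with the
    same coefficients. Thus the span of [B] meets the kernel only in 0. *)
Lemma lincomb_ker_eq0 B s (c : X -> R) :
  {in B &, injective f} -> linearly_independent (f @` B) ->
  uniq s -> [set` s] `<=` B -> f (\sum_(b <- s) c b *: b) = 0 ->
  forall b, b \in s -> c b = 0.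
Proof.
move=> finj fBfree us sB fs0 b bs.
have [g gP] := image_section B.
have gfK : {in s, cancel f g}.
  move=> x /sB Bx; have [Bg fg] := gP _ (imageP f Bx).
  by apply: finj => //; exact/mem_set.
rewrite -(gfK _ bs).
apply: (fBfree [seq f x | x <- s] (c \o g)); last exact: map_f.
- by rewrite map_inj_in_uniq// => x y /sB/mem_set xB /sB/mem_set; exact: finj.
- by move=> _ /mapP[x /sB Bx ->]; exists x.
rewrite big_map -[RHS]fs0 linear_lincomb.
by apply: eq_big_seq => x /= /gfK->.
Qed.

Lemma lineable_preimage (N : set Y) (kappa : Type) :
  (forall y, exists x, f x = y) -> ~ N 0 ->
  lineable kappa (f @^-1` N) <-> lineable kappa N.
Proof.
move=> fsurj N0; split=> [[V [Vsub [B [[Bfree BV] Bk]] VN]]|].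
  (* As [N] misses 0, a vector of [V] in the kernel lies outside the preimage of [N], so it is 0. *)
  have fker v : V v -> f v = 0 -> v = 0.
    by move=> /VN[/= Nfv fv0|//]; rewrite fv0 in Nfv.
  have finj : {in V &, injective f}.
    move=> u v uV vV fuv; apply/eqP; rewrite -subr_eq0; apply/eqP/fker.
      rewrite -scaleN1r addrC; apply/set_mem.
      by case: Vsub => _; apply.
    by rewrite linearB fuv subrr.
  exists (f @` V); split.
  - rewrite -BV image_linear_span; exact: linear_span_submod_closed.
  - exists (f @` B); split; last first.
      apply: card_eq_trans Bk; apply: inj_card_eq.
      have BsV b : B b -> V b.
        move=> Bb; rewrite -BV -[b]scale1r -(big_seq1 +%R b (fun b => 1 *: b)).
        by apply: linear_span_sum => x; rewrite inE => /eqP->.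
      by move=> a b /set_mem/BsV/mem_set aV /set_mem/BsV/mem_set; exact: finj.
    split; last by rewrite -image_linear_span BV.
    by apply: linearly_independent_image => //; rewrite BV.
  - by move=> _ [v /VN[Nv|->] <-]; [left|right; rewrite /= linear0].
move=> [V [Vsub [B [[Bfree BV] Bk]] VN]].
have [s sK] := choice fsurj.
have fsB : f @` (s @` B) = B.
  by rewrite image_comp (eq_imagel (fun y _ => sK y)) image_id.
have finj : {in s @` B &, injective f}.
  by move=> _ _ /set_mem[x _ <-] /set_mem[y _ <-]; rewrite !sK => ->.
exists (linear_span (s @` B)); split.
- exact: linear_span_submod_closed.
- exists (s @` B); split; last first.
    apply: card_eq_trans Bk; apply: inj_card_eq => x y _ _ sxy.
    by rewrite -(sK x) sxy sK.
  split=> // t c ut tB t0; apply: (lincomb_ker_eq0 _ t c finj) => //.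
    by rewrite fsB.
  by rewrite t0 linear0.
move=> v sv; have Vfv : V (f v).
  by rewrite -BV -fsB -image_linear_span; exists v.
(* If [f v] is 0, all coefficients of [v] over the lifted basis vanish, once repetitions are
   merged. *)
have [Nfv|fv0] := VN _ Vfv; [by left|right].
case: sv => t [c [tB vE]]; move: fv0; rewrite /= vE.
rewrite (@lincomb_undup _ _ t t)// => fv0.
rewrite big_seq big1// => b bt.
rewrite (lincomb_ker_eq0 _ _ _ finj _ _ _ fv0) ?scale0r ?undup_uniq ?fsB//.
by move=> x /=; rewrite mem_undup; exact: tB.
Qed.

End LinearImage.

(** * Nonprincipal ultrafilters and compactness of the remainder *)

Lemma remainder_ultra (p : betaN_remainder) : UltraFilter (sval p).
Proof. by case: p => F []. Qed.

#[local] Instance remainder_proper (p : betaN_remainder) :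
  ProperFilter (sval p).
Proof. exact: (@ultra_proper _ _ (remainder_ultra p)). Qed.

Section Remainder.
Implicit Types (p : betaN_remainder) (A C : set nat) (I : set (set nat)).

Lemma remainder_setC p A : ~ sval p A -> sval p (~` A).
Proof. by have [] := in_ultra_setVsetC A (remainder_ultra p). Qed.

(** If no singleton were in [F], the complements of the points of [A] would be, and finitely many of
    them intersect [A] in the empty set. *)
Lemma ultrafilter_finite_principal (F : set_system nat) A :
  UltraFilter F -> finite_set A -> F A -> exists n, F = principal_filter n.
Proof.
move=> FU Afin FA; apply: contrapT => Fnp.
suff FC n : F (~` [set n]).
  have [D AD] := finite_fsetP.1 Afin.
  have : F (\bigcap_(n in A) ~` [set n]) by rewrite AD; apply: filter_bigI.
  move=> /(filterI FA)/filter_ex[n [An /(_ n An)]]; exact.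
have [Fn|//] := in_ultra_setVsetC [set n] FU.
exfalso; apply: Fnp; exists n; apply/seteqP; split=> B.
  by move=> /(filterI Fn)/filter_ex[_ [-> Bn]] _ ->.
by move=> /principal_filterP Bn; apply: filterS Fn => _ ->.
Qed.

Lemma remainder_infinite p A : sval p A -> infinite_set A.
Proof.
case: p => F /= [FU Fnp] FA Afin.
have [n /Fnp] := ultrafilter_finite_principal F A FU Afin FA; exact.
Qed.

(* This is the compactness of the remainder: the clopen sets given by the
   members of [I] cover it, so finitely many of them do. *)
Lemma remainder_ideal I :
  (forall A, finite_set A -> I A) ->
  (forall A C, A `<=` C -> I C -> I A) ->
  (forall A C, I A -> I C -> I (A `|` C)) ->
  (forall p, exists2 A, sval p A & I A) ->
  I setT.
Proof.
move=> Ifin Isub IU Icov; apply: contrapT => IT.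
(* An ultrafilter extending this dual filter contains no member of [I]; it is nonprincipal because
   [I] contains the singletons. *)
have FF : ProperFilter [set A | I (~` A)].
  split=> /=; first by rewrite setC0.
  split=> /=; first by rewrite setCT; apply: Ifin; exact: finite_set0.
    by move=> A C IA IC; rewrite /= setCI; exact: IU.
  by move=> A C AC /=; apply: Isub; exact: subsetC.
have [G [GU FG]] := ultraFilterLemma FF.
have Gnp n : G <> principal_filter n.
  move=> Gn; have : G (~` [set n]) by apply: FG; rewrite /= setCK; exact: Ifin.
  by rewrite Gn => /(_ n erefl) /(_ erefl).
have [/= A GA IA] := Icov (exist _ G (conj GU Gnp)).
have GC : G (~` A) by apply: FG; rewrite /= setCK.
by move: GA => /(filterI GC)/filter_ex[x []].
Qed.

(** Were the remainder empty, the ideal of finite sets would cover it vacuously, making [nat]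
    finite. *)
Lemma remainder_nonempty : [set: betaN_remainder] !=set0.
Proof.
apply: contrapT => noP; apply: infinite_nat.
apply: (remainder_ideal (@finite_set nat)) => //.
- exact: sub_finite_set.
- by move=> A C; rewrite finite_setU.
- by move=> p; exfalso; apply: noP; exists p.
Qed.

Lemma open_stone_base A : open (stone_base A).
Proof. by exists [set A]; [|rewrite bigcup_set1]. Qed.

Lemma stone_base_nbhs p U :
  nbhs p U -> exists2 A, sval p A & stone_base A `<=` U.
Proof.
rewrite nbhsE => -[_ [[D _ <-] [A DA pA]] DU].
by exists A => // q qA; apply: DU; exists A.
Qed.

End Remainder.

(** * Limits of bounded sequences along ultrafilters *)

Section UltraLimit.
Variable R : realType.
Implicit Types (p : betaN_remainder) (x y : l_infty R).

(** The image of [p] lives on a compact segment, so it has a cluster point, and an ultrafilter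
    converges to each of its cluster points. *)
Lemma l_infty_cvg x p : cvg (x @ sval p).
Proof.
have /bounded_seqP[M xM] := valP x.
have : (x @ sval p) [set` `[- M, M]].
  by apply: nearW => n; rewrite /= in_itv/= -ler_norml; exact: xM.
move=> /segment_compact[t [_ tcl]]; apply/cvg_ex; exists t.
apply/cvgrPdist_lt => e e0; apply: contrapT => /remainder_setC pe.
have peb : (x @ sval p) (~` ball t e) by exact: pe.
by have [z []] := tcl _ _ peb (nbhsx_ballx t e e0).
Qed.

Definition ultralim x p : R := lim (x @ sval p).

Lemma ultralim_near x p e : 0 < e ->
  sval p [set n | `|ultralim x p - x n| < e].
Proof. by move: e; apply/cvgrPdist_lt; exact: l_infty_cvg. Qed.

Lemma ultralim_eq x p l : x @ sval p --> l -> ultralim x p = l.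
Proof. by move=> xl; apply: cvg_lim => //; exact: norm_hausdorff. Qed.

Lemma ultralim_continuous x : continuous (ultralim x).
Proof.
move=> p; apply/(@cvgrPdist_le _ _ _ _ (nbhs_filter p)) => e e0.
have e2 : 0 < e / 2 by lra.
have xp := ultralim_near x p _ e2.
have := open_nbhs_nbhs (conj (open_stone_base _) xp).
(* Any [q] containing the same set shares with [p] an index [n] at which [x n] is within [e / 2] of
   both limits. *)
apply: filterS => q xpq.
have := ultralim_near x q _ e2.
move=> /(filterI xpq)/filter_ex[n [/= pn qn]].
rewrite (le_trans (ler_distD (x n) _ _))// (distrC (x n)); lra.
Qed.

Definition ultralim_map x : continuousType betaN_remainder R :=
  mkcts (ultralim_continuous x).

Lemma ultralim_map_is_linear : linear ultralim_map.
Proof.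
move=> a x y; apply/continuousEP => p; apply: ultralim_eq.
apply: cvgD; last exact: l_infty_cvg.
by apply: cvgZr; exact: l_infty_cvg.
Qed.

HB.instance Definition _ := GRing.isLinear.Build R (l_infty R)
  (continuousType betaN_remainder R) _ ultralim_map ultralim_map_is_linear.

Lemma range_ultralim_map x : range (ultralim_map x) = Lim x.
Proof.
apply/seteqP; split=> [_ [p _ <-] e e0|t tx].
  apply: (remainder_infinite p); apply: filterS (ultralim_near x p e e0) => n.
  by rewrite /= ltr_distlC.
apply: contrapT => trange.
(* The sets along which [x] does not accumulate at [t]. If [t] is no ultralimit, every [p] contains
   one of them, so they include all of [nat], against [tx]. *)
pose I : set (set nat) := [set A | exists2 e : R, 0 < e &
  finite_set (A `&` [set n | t - e < x n < t + e])].
suff [e e0] : I setT by rewrite setTI; exact: tx.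
apply: remainder_ideal.
- by move=> A Afin; exists 1 => //; exact: finite_setIl.
- move=> A C AC [e e0 Cfin]; exists e => //.
  by apply: sub_finite_set Cfin; exact: setSI.
- move=> A C [d d0 Afin] [e e0 Cfin]; exists (Num.min d e).
    by rewrite lt_min d0.
  rewrite setIUl finite_setU; split.
    apply: sub_finite_set Afin; apply: setIS => n /=.
    by case: (leP d e) => /=; lra.
  apply: sub_finite_set Cfin; apply: setIS => n /=.
  by case: (leP d e) => /=; lra.
(* With half the distance from the limit to [t] as radius, no [x n] is close to both. *)
- move=> p; have txp : 0 < `|ultralim x p - t| / 2.
    rewrite divr_gt0// normr_gt0 subr_eq0; apply/eqP => xpt.
    by apply: trange; exists p.
  exists [set n | `|ultralim x p - x n| < `|ultralim x p - t| / 2].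
    exact: ultralim_near.
  exists (`|ultralim x p - t| / 2) => //.
  apply: (@sub_finite_set _ _ set0); last exact: finite_set0.
  move=> n [/= xpn]; rewrite -ltr_distlC => xnt.
  have := ler_distD (x n) (ultralim x p) t; rewrite (distrC (x n) t); lra.
Qed.

End UltraLimit.

(** * Continuous functions on the remainder as ultralimits of bounded sequences *)

Section Extension.
Variables (R : realType) (f : betaN_remainder -> R).
Hypothesis f_continuous : continuous f.
Implicit Type p : betaN_remainder.

Lemma approx_extension (e : R) : 0 < e ->
  exists2 x : nat -> R, (exists M, forall n, `|x n| <= M) &
    forall p, sval p [set n | `|x n - f p| < e].
Proof.
move=> e0.
(* Approximations over [A] and [C] glue to one over [A `|` C], and near each
   point of the remainder a constant will do. *)
pose I : set (set nat) := [set A | exists2 x : nat -> R,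
  (exists M, forall n, `|x n| <= M) &
  forall p, sval p A -> sval p [set n | `|x n - f p| < e]].
suff [x xM xf] : I setT by exists x => // p; apply: xf; exact: filterT.
apply: remainder_ideal.
- move=> A Afin; exists (fun=> 0); first by exists 0 => n; rewrite normr0.
  by move=> p /remainder_infinite.
- by move=> A C AC [x xM xf]; exists x => // p pA; apply: xf; exact: filterS pA.
- move=> A C [x [M xM] xf] [y [N yN] yf].
  exists (fun n => if n \in A then x n else y n).
    exists (Num.max M N) => n; rewrite le_max.
    by case: ifP => _; rewrite ?xM ?yN ?orbT.
  (* Either [A] or the part of [C] outside [A] is in [p]; the glued sequence is [x] on the former
     and [y] on the latter. *)
  move=> p pAC; have [pA|/remainder_setC pA] := pselect (sval p A).
    by apply: filterS (filterI pA (xf p pA)) => n [An] /=; rewrite (mem_set An).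
  have pC : sval p C by apply: filterS (filterI pAC pA) => n [[]].
  by apply: filterS (filterI pA (yf p pC)) => n [nAn] /=; rewrite (memNset nAn).
- move=> p.
  have /cvgrPdist_lt/(_ e e0)/stone_base_nbhs[A pA Af] := f_continuous p.
  exists A => //; exists (fun=> f p); first by exists `|f p|.
  by move=> q /Af /=; rewrite distrC => fqp; apply: nearW => n.
Qed.

Lemma extension_exists :
  exists2 x : nat -> R, (exists M, forall n, `|x n| <= M) &
    forall p, x @ sval p --> f p.
Proof.
(* A diagonal sequence: at [n] use the finest approximation [a k], [k <= n],
   that is consistent at [n] with all the coarser ones. *)
pose eps (k : nat) : R := k.+1%:R^-1.
have eps0 k : 0 < eps k by rewrite invr_gt0.
have /choice[a aP] k : exists x : nat -> R, (exists M, forall n, `|x n| <= M) /\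
    forall p, sval p [set n | `|x n - f p| < eps k].
  by have [x xM xf] := approx_extension (eps k) (eps0 k); exists x.
pose good n k := all (fun i => `|a i n - a k n| < eps i + eps k) (iota 0 k).
(* Index 0 is vacuously consistent, so a largest one exists. *)
have good0 n : exists k, (k <= n)%N && good n k by exists 0%N.
have goodn n k : (k <= n)%N && good n k -> (k <= n)%N by case/andP.
pose m n := ex_maxn (good0 n) (goodn n).
have mE n i : (i <= m n)%N -> `|a i n - a (m n) n| < eps i + eps (m n).
  rewrite leq_eqVlt => /predU1P[->|im].
    by rewrite subrr normr0 addr_gt0.
  rewrite /m in im *; case: ex_maxnP im => k /andP[_ /allP gk] _ ik.
  by apply: gk; rewrite mem_iota.
(* For [p]-almost all [n], the approximations up to [k] are all near [f p], hence consistent with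
   [a k] at [n]. *)
have pm p k : sval p [set n | (k <= m n)%N].
  have p_ge : sval p [set n | (k <= n)%N].
    apply: contrapT => /remainder_setC/remainder_infinite; apply.
    apply: (@sub_finite_set _ _ `I_k); last exact: finite_II.
    by move=> n /= /negP; rewrite -ltnNge.
  have p_good : sval p [set n | good n k].
    have pa i : sval p [set n | `|a i n - f p| < eps i] by exact: (aP i).2.
    rewrite /good; elim: (iota 0 k) => [|i s IH]; first exact: nearW.
    apply: filterS (filterI IH (filterI (pa i) (pa k))) => n [/= -> [ain akn]].
    rewrite andbT (le_lt_trans (ler_distD (f p) _ _))// (distrC (f p)).
    exact: ltrD.
  apply: filterS (filterI p_ge p_good) => n [/= kn kgood].
  by rewrite /m; case: ex_maxnP => j _ /(_ k); rewrite kn kgood => /(_ isT).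
exists (fun n => a (m n) n).
  (* Consistency with [a 0] bounds the diagonal sequence. *)
  have [M aM] := (aP 0%N).1; exists (M + (eps 0%N + eps 0%N)) => n.
  have := mE n 0%N isT; rewrite distrC => amn.
  have em : eps (m n) <= eps 0%N by rewrite lef_pV2 ?posrE// ler_nat.
  have := ler_normD (a 0%N n) (a (m n) n - a 0%N n); rewrite subrKC => h.
  have := aM n; lra.
move=> p; apply/cvgrPdist_lt => e e0.
(* One [eps k] bounds the distance from [f p] to [a k n], and two more that from [a k n] to the
   diagonal term. *)
have [k ke] : exists k, eps k < e / 3.
  have /archi_boundP := ltW (divr_gt0 (ltr0Sn R 2) e0) => ke.
  exists (Num.bound (3 / e)); rewrite /eps.
  rewrite -[ltRHS]invrK ltf_pV2 ?posrE ?invr_gt0 ?divr_gt0//.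
  by rewrite invf_div (lt_le_trans ke)// ler_nat.
apply: filterS (filterI (pm p k) ((aP k).2 p)) => n [/= km akf].
have := mE n k km.
have em : eps (m n) <= eps k by rewrite lef_pV2 ?posrE// ler_nat.
have := ler_distD (a k n) (f p) (a (m n) n).
rewrite (distrC (f p) (a k n)); lra.
Qed.

End Extension.

Lemma ultralim_map_surjective (R : realType)
    (f : continuousType betaN_remainder R) : exists x, ultralim_map R x = f.
Proof.
have [x /bounded_seqP xb xf] := extension_exists R f (@cts_fun _ _ f).
exists (LInfty xb); apply/continuousEP => p; exact: ultralim_eq.
Qed.

Theorem proposition3 (R : realType) (P : set (set R))
    (P_compact : forall A : set R, P A -> compact A)
    (P_zero : ~ P [set 0])
    (kappa : Type) :
  lineable kappa [set f : continuousType betaN_remainder R | P (range f)] <->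
  lineable kappa [set x : l_infty R | P (Lim x)].
Proof.
have -> : [set x : l_infty R | P (Lim x)] = ultralim_map R @^-1`
    [set f : continuousType betaN_remainder R | P (range f)].
  by apply/seteqP; split=> x /=; rewrite range_ultralim_map.
apply: iff_sym; apply: lineable_preimage; first exact: ultralim_map_surjective.
(* A point of the remainder makes the range of the zero function [{0}] instead of empty, so [P_zero]
   excludes that function. *)
have [p _] := remainder_nonempty.
suff r0 : range (0 : continuousType betaN_remainder R) = [set 0].
  by move: P_zero; rewrite /= r0.
by apply/seteqP; split=> [_ [q _ <-]|_ ->]; last exists p.
Qed.
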